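(* Fix $\lambda\in(0,\infty)$ and positive integers $n,m$. Let $\mathcal{M}$ be the set of $n\times m$ matrices with all entries positive, and let $\Delta^+_n$ and $\Delta^+_m$ be the sets of probability vectors of length $n$ and $m$ with all entries positive. Define $\Phi:\mathcal{M}\times\Delta^+_n\times\Delta^+_m\to\mathcal{M}$ by letting $\Phi(M,\mathbf{r},\mathbf{c})$ be the limit of $(\mathbf{r},\mathbf{c})$-Sinkhorn scaling applied to the matrix $M^{[\lambda]}$. Then $\Phi$ is $C^\infty$.
   Context: $M^{[\lambda]}$ denotes the matrix with entries $(M_{ij})^{\lambda}$. $(\mathbf{r},\mathbf{c})$-Sinkhorn scaling of a non-negative matrix $A$ is the iterated alternation of rescaling each row $i$ so that its sum equals $r_i$ and rescaling each column $j$ so that its sum equals $c_j$; for positive matrices and positive probability vectors this converges to the unique matrix of the form $D_1 A D_2$ ($D_1,D_2$ positive diagonal) with row sums $\mathbf{r}$ and column sums $\mathbf{c}$. $\Delta^+_n\times\Delta^+_m$ is regarded as an open subset of the product of the affine hyperplanes $\{\sum_i r_i=1\}$, $\{\sum_j c_j=1\}$. *)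

(* Defs.v *)
From HB Require Import structures.
From mathcomp Require Import all_boot all_order all_algebra.
From mathcomp Require Import all_classical all_reals all_analysis.
Set Implicit Arguments. Unset Strict Implicit. Unset Printing Implicit Defensive.
Import Order.TTheory GRing.Theory Num.Theory.
Import numFieldNormedType.Exports.
Local Open Scope classical_set_scope.
Local Open Scope ring_scope.

Section Sinkhorn.
Variables (R : realType) (n m : nat).

Definition mx_pow (lam : R) (M : 'M[R]_(n, m)) : 'M[R]_(n, m) :=
  \matrix_(i, j) (M i j `^ lam).

Definition row_scale (r : 'rV[R]_n) (A : 'M[R]_(n, m)) : 'M[R]_(n, m) :=
  \matrix_(i, j) (r 0 i * A i j / \sum_(k < m) A i k).

Definition col_scale (c : 'rV[R]_m) (A : 'M[R]_(n, m)) : 'M[R]_(n, m) :=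
  \matrix_(i, j) (c 0 j * A i j / \sum_(k < n) A k j).

Definition sinkhorn_seq (r : 'rV[R]_n) (c : 'rV[R]_m) (A : 'M[R]_(n, m))
  : nat -> 'M[R]_(n, m) :=
  fun k => iter k (fun B => col_scale c (row_scale r B)) A.

Definition sinkhorn_limit (r : 'rV[R]_n) (c : 'rV[R]_m) (A : 'M[R]_(n, m))
  : 'M[R]_(n, m) := lim (sinkhorn_seq r c A @ \oo).

Definition Phi (lam : R) (x : 'M[R]_(n, m) * ('rV[R]_n * 'rV[R]_m))
  : 'M[R]_(n, m) := sinkhorn_limit x.2.1 x.2.2 (mx_pow lam x.1).

Definition pos_prob {k : nat} (p : 'rV[R]_k) : Prop :=
  (forall i, 0 < p 0 i) /\ \sum_(i < k) p 0 i = 1.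

Definition Phi_dom : set ('M[R]_(n, m) * ('rV[R]_n * 'rV[R]_m)) :=
  [set x : 'M[R]_(n, m) * ('rV[R]_n * 'rV[R]_m) | (forall (i : 'I_n) (j : 'I_m), 0 < x.1 i j) /\ pos_prob x.2.1 /\ pos_prob x.2.2].

Definition Phi_tangent : set ('M[R]_(n, m) * ('rV[R]_n * 'rV[R]_m)) :=
  [set v : 'M[R]_(n, m) * ('rV[R]_n * 'rV[R]_m) | \sum_(i < n) v.2.1 0 i = 0 /\ \sum_(j < m) v.2.2 0 j = 0].

End Sinkhorn.

Definition iter_deriv (R : numFieldType) (V W : normedModType R)
  (f : V -> W) (vs : seq V) : V -> W :=
  foldr (fun v g => fun x => 'D_v g x) f vs.

(** C^infinity on a set D which is open in an affine subspace with
    direction space T: all iterated directional derivatives along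
    directions in T exist at every point of D, and all of them
    (including f itself) are continuous on D. *)
Definition smooth_on (R : numFieldType) (V W : normedModType R)
  (T D : set V) (f : V -> W) : Prop :=
  forall vs : seq V, (forall v, v \in vs -> T v) ->
    {within D, continuous (iter_deriv f vs)} /\
    (forall v x, T v -> D x -> derivable (iter_deriv f vs) x v).

(* Main.v *)
Require Import Defs.
From HB Require Import structures.
From mathcomp Require Import all_boot all_order all_algebra.
From mathcomp Require Import all_classical all_reals all_analysis.
From mathcomp Require Import ring lra.
Set Implicit Arguments.
Unset Strict Implicit.
Unset Printing Implicit Defensive.
Import Order.TTheory GRing.Theory Num.Theory.
Import numFieldNormedType.Exports.
Local Open Scope classical_set_scope.
Local Open Scope ring_scope.

(* Write B = Phi(M, r, c).  The potential sum_ij r_i c_j ln B_ij increases along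
   the Sinkhorn iteration by the relative entropies of the marginals, and it is
   bounded above; hence the row sums converge to r.  Two matrices B, B' whose
   logarithms differ by w_ij + d_i + e_j satisfy
     sum (B' - B)^2 <= sum (B' - B) (ln B' - ln B),
   and the right-hand side is controlled by w and by the differences of the
   marginals.  This makes the iteration Cauchy and Phi continuous; the lower
   bound on B which it requires comes from the cross ratios, preserved by scaling.

   For differentiability, B' - B = L (ln B' - ln B) entrywise, with L the
   logarithmic mean.  So (d, e) solves exactly a linear system whose matrix is the
   Laplacian of the complete bipartite graph with weights L, grounded at one
   vertex so as to be invertible.  Letting B' tend to B, the directional
   derivatives of Phi are rational functions of the entries of Phi and M, and all
   higher derivatives follow by the chain rule. *)

(** * Relative entropy and logarithmic means *)

Section LogInequalities.
Variable R : realType.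
Implicit Types x y : R.

Lemma ln_le_subr1 x : 0 < x -> ln x <= x - 1.
Proof.
move=> x0; have := @le_ln1Dx R (x - 1).
by rewrite addrCA subrr addr0; apply; lra.
Qed.

Lemma ln_diff_le x y : 0 < x -> 0 < y -> ln x - ln y <= (x - y) / y.
Proof.
move=> x0 y0; rewrite -ln_div ?posrE// mulrBl divff ?gt_eqF//.
exact/ln_le_subr1/divr_gt0.
Qed.

Lemma ln_diff_ge x y : 0 < x -> 0 < y -> (x - y) / x <= ln x - ln y.
Proof.
move=> x0 y0; have := ln_diff_le y0 x0.
by rewrite -(opprB x y) mulNr; lra.
Qed.

(** The logarithm has slope at least 1 on $(0,1]$: for $y \le x$, [ln_diff_ge] gives $\ln x - \ln y
    \ge (x-y)/x \ge x-y$. *)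
Lemma sqr_sub_le_mul_ln x y : 0 < x <= 1 -> 0 < y <= 1 ->
  (x - y) ^+ 2 <= (x - y) * (ln x - ln y).
Proof.
wlog yx : x y / y <= x.
  move=> H x01 y01; have [|/ltW xy] := leP y x; first by move=> /H; apply.
  by rewrite -sqrrN opprB -mulrNN !opprB; exact: H.
move=> /andP[x0 x1] /andP[y0 y1].
rewrite expr2 ler_wpM2l ?subr_ge0//.
apply: le_trans (ln_diff_ge x0 y0).
by rewrite ler_pdivlMr// ler_piMr// subr_ge0.
Qed.

(** The diagonal value is the continuous extension; with it [sub_logmean] holds without excluding
    [x = y]. *)
Definition logmean x y : R :=
  if x == y then y else (x - y) / (ln x - ln y).

Lemma logmean_itv x y : 0 < x -> 0 < y ->
  Num.min x y <= logmean x y <= Num.max x y.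
Proof.
wlog yx : x y / y <= x.
  move=> H x0 y0; have /orP[|xy] := le_total y x; first by move=> /H; apply.
  have := H y x xy y0 x0; rewrite minC maxC /logmean eq_sym.
  case: eqP => [->//|_].
  by rewrite -(opprB x y) -(opprB (ln x)) invrN mulrNN.
move=> x0 y0; rewrite (min_r yx) (max_l yx) /logmean.
case: eqP => [xy|/eqP xy]; first by rewrite lexx yx.
have lt_yx : y < x by rewrite lt_neqAle eq_sym xy.
have lnd : 0 < ln x - ln y by rewrite subr_gt0 ltr_ln ?posrE.
rewrite ler_pdivlMr// ler_pdivrMr//.
have := ln_diff_le x0 y0; have := ln_diff_ge x0 y0.
by rewrite ler_pdivlMr// ler_pdivrMr// ![_ * (ln x - _)]mulrC => -> ->.
Qed.

Lemma logmean_gt0 x y : 0 < x -> 0 < y -> 0 < logmean x y.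
Proof.
move=> x0 y0; have /andP[+ _] := logmean_itv x0 y0.
by apply: lt_le_trans; rewrite lt_min x0.
Qed.

Lemma logmean_dist x y : 0 < x -> 0 < y -> `|logmean x y - y| <= `|x - y|.
Proof.
move=> x0 y0; have /andP[] := logmean_itv x0 y0.
case: (leP x y) => xy.
  by move=> ? ?; rewrite !ler0_norm ?subr_le0//; lra.
by move=> ? ?; rewrite !ger0_norm ?subr_ge0//; lra.
Qed.

Lemma sub_logmean x y : 0 < x -> 0 < y ->
  x - y = logmean x y * (ln x - ln y).
Proof.
move=> x0 y0; rewrite /logmean; case: eqP => [->|xy]; first by rewrite !subrr mulr0.
by rewrite mulfVK// subr_eq0; apply/eqP => /ln_inj; rewrite !posrE => /(_ x0 y0).
Qed.

(** A Pinsker-type bound through the Hellinger distance: the relative entropy dominates $\sum(\sqrt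
    p-\sqrt q)^2$, and $(p-q)^2=(\sqrt p-\sqrt q)^2(\sqrt p+\sqrt q)^2$, where the last factor is at
    most 4. *)
Lemma sqr_dist_le_kl (I : finType) (p q : I -> R) :
  (forall i, 0 < p i <= 1) -> (forall i, 0 < q i <= 1) ->
  \sum_i p i = \sum_i q i ->
  forall i, (p i - q i) ^+ 2 <= 4 * \sum_k p k * (ln (p k) - ln (q k)).
Proof.
move=> p01 q01 pq i.
have L a b : 0 < a -> 0 < b ->
    (a - b) ^+ 2 <= a ^+ 2 * (ln (a ^+ 2) - ln (b ^+ 2)) + (b ^+ 2 - a ^+ 2) :> R.
  move=> a0 b0; rewrite !lnXn//.
  have := ln_diff_le b0 a0; rewrite ler_pdivlMr// => h.
  have : a * ((ln b - ln a) * a) <= a * (b - a) by rewrite ler_pM2l.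
  lra.
(* The correction [q k - p k] makes the inequality true term by term; it cancels in the sum because
   the totals agree. *)
have H k : (Num.sqrt (p k) - Num.sqrt (q k)) ^+ 2
    <= p k * (ln (p k) - ln (q k)) + (q k - p k).
  have /andP[pk0 _] := p01 k; have /andP[qk0 _] := q01 k.
  have := L (Num.sqrt (p k)) (Num.sqrt (q k)).
  by rewrite !sqrtr_gt0 (sqr_sqrtr (ltW pk0)) (sqr_sqrtr (ltW qk0)); apply.
have Hs : \sum_k (Num.sqrt (p k) - Num.sqrt (q k)) ^+ 2
    <= \sum_k p k * (ln (p k) - ln (q k)).
  apply: le_trans (ler_sum _ (fun k _ => H k)) _.
  by rewrite big_split/= sumrB pq subrr addr0.
apply: le_trans (_ : 4 * (Num.sqrt (p i) - Num.sqrt (q i)) ^+ 2 <= _); last first.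
  rewrite ler_pM2l//; apply: le_trans Hs; rewrite (bigD1 i)//= lerDl.
  by apply: sumr_ge0 => k _; exact: sqr_ge0.
have /andP[pi0 pi1] := p01 i; have /andP[qi0 qi1] := q01 i.
rewrite -{1}(sqr_sqrtr (ltW pi0)) -{1}(sqr_sqrtr (ltW qi0)).
have sp1 : Num.sqrt (p i) <= 1 by rewrite -sqrtr1 ler_wsqrtr.
have sq1 : Num.sqrt (q i) <= 1 by rewrite -sqrtr1 ler_wsqrtr.
have := sqrtr_ge0 (p i); have := sqrtr_ge0 (q i).
move: sp1 sq1; set a := Num.sqrt _; set b := Num.sqrt _ => a1 b1 b0 a0.
rewrite subr_sqr exprMn mulrC ler_wpM2r ?sqr_ge0//.
by nra.
Qed.

End LogInequalities.

(** * Comparison of two scalings *)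

Section Scaling.
Variables (R : realType) (n m : nat).
Implicit Types (A B : 'M[R]_(n, m)) (r : 'rV[R]_n) (c : 'rV[R]_m).

(** Equivalent to $e_{ij}=d_i+f_j$, but stated without choosing the potentials, which are unique
    only up to a shift. *)
Definition separable (e : 'I_n -> 'I_m -> R) : Prop :=
  forall i k j l, e i j + e k l = e i l + e k j.

Lemma separableB (e f : 'I_n -> 'I_m -> R) : separable e -> separable f ->
  separable (fun i j => e i j - f i j).
Proof.
by move=> se sf i k j l; have := se i k j l; have := sf i k j l; lra.
Qed.

(** Pairing with a separable array sees only the marginals of [D]; the constant [e i0 j0] drops out
    because [D] has total 0. *)
Lemma sum_separable (e : 'I_n -> 'I_m -> R) (D : 'I_n -> 'I_m -> R) i0 j0 :
  separable e -> \sum_i \sum_j D i j = 0 ->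
  \sum_i \sum_j D i j * e i j =
  \sum_i (\sum_j D i j) * e i j0 + \sum_j (\sum_i D i j) * e i0 j.
Proof.
move=> sep D0.
have eE i j : e i j = e i j0 + e i0 j - e i0 j0.
  by have := sep i i0 j j0; lra.
under eq_bigr => i _ do under eq_bigr => j _ do rewrite eE mulrBr mulrDr.
under eq_bigr => i _ do rewrite sumrB big_split/= -mulr_suml -mulr_suml.
rewrite sumrB big_split/= -mulr_suml D0 mul0r subr0; congr (_ + _).
by rewrite exchange_big/=; apply: eq_bigr => j _; rewrite mulr_suml.
Qed.

(** By [sqr_sub_le_mul_ln] the left side is at most $\sum(B'-B)(\ln B'-\ln B)$. The log difference
    is [w] plus a separable part, and the latter is paired with marginal differences only. *)
Lemma scaling_dist B B' (w : 'I_n -> 'I_m -> R) (k : R) i0 j0 :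
  0 < k -> (forall i j, k <= B i j <= 1) -> (forall i j, k <= B' i j <= 1) ->
  \sum_i \sum_j B' i j = \sum_i \sum_j B i j ->
  separable (fun i j => ln (B' i j) - ln (B i j) - w i j) ->
  \sum_i \sum_j (B' i j - B i j) ^+ 2 <=
    \sum_i \sum_j `|w i j|
    + \sum_i `|\sum_j B' i j - \sum_j B i j| * (`|w i j0| - ln k)
    + \sum_j `|\sum_i B' i j - \sum_i B i j| * (`|w i0 j| - ln k).
Proof.
move=> k0 Bk Bk' tot sep.
have gt0 i j : 0 < B i j by have /andP[+ _] := Bk i j; exact: lt_le_trans.
have gt0' i j : 0 < B' i j by have /andP[+ _] := Bk' i j; exact: lt_le_trans.
have lnk0 x : k <= x <= 1 -> ln k <= ln x <= 0.
  move=> /andP[kx x1]; have x0 := lt_le_trans k0 kx.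
  by rewrite ln_le0// ler_ln ?posrE// kx.
(* Both logarithms lie in $[\ln k, 0]$, so they differ by at most $-\ln k$. *)
have e_le i j : `|ln (B' i j) - ln (B i j) - w i j| <= `|w i j| - ln k.
  rewrite addrC; apply: le_trans (ler_normD _ _) _; rewrite normrN lerD2l.
  have /andP[? ?] := lnk0 _ (Bk i j); have /andP[? ?] := lnk0 _ (Bk' i j).
  by rewrite ler_norml; apply/andP; split; lra.
have DM (x y z : R) : `|y| <= z -> x * y <= `|x| * z.
  by move=> yz; apply: le_trans (ler_norm _) _; rewrite normrM ler_wpM2l.
apply: (@le_trans _ _ (\sum_i \sum_j ((B' i j - B i j) * w i j +
    (B' i j - B i j) * (ln (B' i j) - ln (B i j) - w i j)))).
  apply: ler_sum => i _; apply: ler_sum => j _.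
  rewrite -mulrDr [w i j + _]addrC subrK; apply: sqr_sub_le_mul_ln.
    by rewrite gt0'; have /andP[_ ->] := Bk' i j.
  by rewrite gt0; have /andP[_ ->] := Bk i j.
under eq_bigr => i _ do rewrite big_split/=.
rewrite big_split/= -addrA; apply: lerD.
  apply: ler_sum => i _; apply: ler_sum => j _.
  apply: le_trans (ler_norm _) _; rewrite normrM ler_piMl//.
  have /andP[? ?] := Bk i j; have /andP[? ?] := Bk' i j.
  by rewrite ler_norml; apply/andP; split; lra.
rewrite (sum_separable i0 j0 sep); last first.
  by under eq_bigr do rewrite sumrB; rewrite sumrB tot subrr.
by apply: lerD; apply: ler_sum => i _; rewrite sumrB; apply: DM.
Qed.

Definition coupling r c B : Prop := [/\ forall i j, 0 < B i j,
  forall i, \sum_j B i j = r 0 i & forall j, \sum_i B i j = c 0 j].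

(** For positive matrices, the logarithmic form of $B = D_1 A D_2$. *)
Definition is_scaling A B : Prop :=
  separable (fun i j => ln (B i j) - ln (A i j)).

Lemma coupling_le1 r c B i j : pos_prob r -> coupling r c B -> B i j <= 1.
Proof.
move=> [_ r1] [B0 Br _]; rewrite -r1 (bigD1 i)//= -Br (bigD1 j)//= -addrA lerDl.
rewrite addr_ge0//; apply: sumr_ge0 => k _; first exact: ltW.
by rewrite -Br; apply: sumr_ge0 => l _; exact: ltW.
Qed.

(** Scaling preserves cross ratios, and those of [A] are at most $(b/a)^2$. Summing $B_{il}B_{kj}\le
    (b/a)^2B_{ij}B_{kl}$ over $k,l$ turns the left side into $r_ic_j$ and the right side into
    $(b/a)^2B_{ij}$. *)
Lemma scaling_lower_bound r c A B (a b : R) :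
  pos_prob r -> coupling r c B -> is_scaling A B ->
  0 < a -> (forall i j, a <= A i j <= b) ->
  forall i j, (a / b) ^+ 2 * (r 0 i * c 0 j) <= B i j.
Proof.
move=> [_ r1] [B0 Br Bc] sc a0 Aab i j.
have b0 : 0 < b by have /andP[] := Aab i j; lra.
have A0 k l : 0 < A k l by have /andP[] := Aab k l; lra.
have lnA k l : ln a <= ln (A k l) <= ln b.
  by have /andP[? ?] := Aab k l; rewrite !ler_ln ?posrE// ?Aab.
have H k l : B i l * B k j <= (b / a) ^+ 2 * (B i j * B k l).
  have ba0 : 0 < (b / a) ^+ 2 by rewrite exprn_gt0 ?divr_gt0.
  have BB p q s t : 0 < B p q * B s t by rewrite mulr_gt0.
  rewrite -ler_ln ?posrE ?(mulr_gt0 ba0)// [ln (_ ^+ 2 * _)]lnM ?posrE//.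
  rewrite [ln (B i l * _)]lnM ?posrE// [ln (B i j * _)]lnM ?posrE//.
  rewrite lnXn ?divr_gt0// ln_div ?posrE//.
  have := sc i k j l.
  have /andP[? ?] := lnA i j; have /andP[? ?] := lnA k l.
  have /andP[? ?] := lnA i l; have /andP[? ?] := lnA k j.
  rewrite mulr2n; lra.
have : \sum_k \sum_l B i l * B k j <=
    \sum_k \sum_l (b / a) ^+ 2 * (B i j * B k l).
  apply: ler_sum => p _; apply: ler_sum => q _; exact: H.
under eq_bigr => k _ do rewrite -mulr_suml Br.
rewrite -mulr_sumr Bc.
under [in leRHS]eq_bigr => k _ do rewrite -mulr_sumr -mulr_sumr Br.
rewrite -mulr_sumr -mulr_sumr r1 mulr1 => h.
by rewrite -(invf_div b a) exprVn ler_pdivrMl ?exprn_gt0 ?divr_gt0.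
Qed.

End Scaling.

Lemma psumr_gt0 (R : numDomainType) (I : finType) (F : I -> R) (i : I) :
  (forall k, 0 < F k) -> 0 < \sum_k F k.
Proof.
move=> F0; rewrite (bigD1 i)//= ltr_pwDl//.
by apply: sumr_ge0 => k _; exact: ltW.
Qed.

(** * Convergence of Sinkhorn scaling *)

Section SinkhornStep.
Variables (R : realType) (n m : nat) (r : 'rV[R]_n) (c : 'rV[R]_m).
Hypotheses (r_prob : pos_prob r) (c_prob : pos_prob c).
Implicit Types (A B : 'M[R]_(n, m)).

Let step B := col_scale c (row_scale r B).

(** Up to a constant independent of [B], minus the relative entropy of the product $r_ic_j$ with
    respect to [B]. *)
Definition potential B : R := \sum_i \sum_j r 0 i * c 0 j * ln (B i j).

Lemma row_scale_gt0 B : (forall i j, 0 < B i j) ->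
  forall i j, 0 < row_scale r B i j.
Proof.
case: r_prob => r0 _ B0 i j; rewrite mxE divr_gt0 ?mulr_gt0//.
exact: (psumr_gt0 j).
Qed.

Lemma step_gt0 B : (forall i j, 0 < B i j) -> forall i j, 0 < step B i j.
Proof.
case: c_prob => c0 _ B0 i j; rewrite mxE divr_gt0 ?mulr_gt0 ?row_scale_gt0//.
by apply: (psumr_gt0 i) => k; exact: row_scale_gt0.
Qed.

Lemma ln_step B : (forall i j, 0 < B i j) -> forall i j,
  ln (step B i j) = ln (B i j) + (ln (r 0 i) - ln (\sum_k B i k))
    + (ln (c 0 j) - ln (\sum_k row_scale r B k j)).
Proof.
case: r_prob c_prob => r0 _ [c0 _] B0 i j.
have S1 : 0 < \sum_k B i k by exact: (psumr_gt0 j).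
have S2 : 0 < \sum_k row_scale r B k j.
  by apply: (psumr_gt0 i) => k; exact: row_scale_gt0.
have P1 : 0 < row_scale r B i j by exact: row_scale_gt0.
rewrite /step mxE ln_div ?posrE ?mulr_gt0// lnM ?posrE//.
rewrite [row_scale r B i j]mxE ln_div ?posrE ?mulr_gt0// lnM ?posrE//.
by ring.
Qed.

Lemma is_scaling_step B : (forall i j, 0 < B i j) -> is_scaling B (step B).
Proof. by move=> B0 i k j l; rewrite !ln_step//; ring. Qed.

Lemma step_col_sum B : (0 < n)%N -> (forall i j, 0 < B i j) ->
  forall j, \sum_i step B i j = c 0 j.
Proof.
move=> n0 B0 j; under eq_bigr do rewrite mxE.
rewrite -mulr_suml -mulr_sumr mulfK// gt_eqF//.
by apply: (psumr_gt0 (Ordinal n0)) => k; exact: row_scale_gt0.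
Qed.

Lemma row_scale_row_sum B : (0 < m)%N -> (forall i j, 0 < B i j) ->
  forall i, \sum_j row_scale r B i j = r 0 i.
Proof.
move=> m0 B0 i; under eq_bigr do rewrite mxE.
rewrite -mulr_suml -mulr_sumr mulfK// gt_eqF//.
exact: (psumr_gt0 (Ordinal m0)).
Qed.

Lemma entry_le1 B : (forall i j, 0 < B i j) -> \sum_i \sum_j B i j = 1 ->
  forall i j, B i j <= 1.
Proof.
move=> B0 B1 i j; rewrite -B1 (bigD1 i)//= (bigD1 j)//= -addrA lerDl.
by rewrite addr_ge0//; repeat (apply: sumr_ge0 => ? _); exact: ltW.
Qed.

Lemma sum_le1 B : (forall i j, 0 < B i j) -> \sum_i \sum_j B i j = 1 ->
  (forall i, \sum_j B i j <= 1) /\ (forall j, \sum_i B i j <= 1).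
Proof.
move=> B0 B1; split => [i|j].
  rewrite -B1 (bigD1 i)//= lerDl.
  by repeat (apply: sumr_ge0 => ? _); exact: ltW.
rewrite -B1 exchange_big/= (bigD1 j)//= lerDl.
by repeat (apply: sumr_ge0 => ? _); exact: ltW.
Qed.

(** The potential gains exactly the relative entropies [klr] and [klc] of the prescribed marginals
    with respect to the current ones. Both are nonnegative, and [klr] controls the row defect. *)
Lemma potential_step B : (0 < n)%N -> (0 < m)%N -> (forall i j, 0 < B i j) ->
  \sum_i \sum_j B i j = 1 ->
  forall i, (r 0 i - \sum_j B i j) ^+ 2 <=
    4 * (potential (step B) - potential B).
Proof.
move=> n0 m0 B0 B1; case: (r_prob) (c_prob) => r0 r1 [c0 c1].
have [row_le1 _] := sum_le1 B0 B1.
have C0 := row_scale_gt0 B0.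
have C1 : \sum_i \sum_j row_scale r B i j = 1.
  by rewrite -r1; apply: eq_bigr => i _; exact: row_scale_row_sum.
have [_ col_le1] := sum_le1 C0 C1.
have le1 k (p : 'rV[R]_k) i : pos_prob p -> p 0 i <= 1.
  move=> [p0 <-]; rewrite (bigD1 i)//= lerDl.
  by apply: sumr_ge0 => ? _; exact: ltW.
have rS i : 0 < \sum_j B i j by exact: (psumr_gt0 (Ordinal m0)).
have cS j : 0 < \sum_i row_scale r B i j.
  exact: (psumr_gt0 (Ordinal n0)).
pose klr := \sum_i r 0 i * (ln (r 0 i) - ln (\sum_j B i j)).
pose klc := \sum_j c 0 j * (ln (c 0 j) - ln (\sum_i row_scale r B i j)).
have -> : potential (step B) - potential B = klr + klc.
  have lnE i j : ln (step B i j) - ln (B i j) =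
      (ln (r 0 i) - ln (\sum_k B i k))
      + (ln (c 0 j) - ln (\sum_k row_scale r B k j)).
    by rewrite ln_step//; ring.
  rewrite /potential -sumrB; under eq_bigr => i _ do rewrite -sumrB.
  under eq_bigr => i _ do under eq_bigr => j _ do
    rewrite -mulrBr lnE mulrDr.
  under eq_bigr => i _ do rewrite big_split/=.
  rewrite big_split/=; congr (_ + _).
    apply: eq_bigr => i _; rewrite -mulr_suml -mulr_sumr c1 mulr1//.
  rewrite exchange_big/=; apply: eq_bigr => j _.
  by rewrite -mulr_suml -mulr_suml r1 mul1r.
(* Nonnegativity is read off [sqr_dist_le_kl] at one arbitrary column. *)
have klc0 : 0 <= klc.
  have := sqr_dist_le_kl (p := fun j => c 0 j)
    (q := fun j => \sum_i row_scale r B i j).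
  move=> /(_ _ _ _ (Ordinal m0)) h.
  rewrite -(pmulr_rge0 _ (ltr0n R 4)); apply: le_trans (h _ _ _).
  - exact: sqr_ge0.
  - by move=> j; rewrite c0 le1.
  - by move=> j; rewrite cS col_le1.
  - by rewrite c1 exchange_big.
move=> i; apply: (@le_trans _ _ (4 * klr)); last by rewrite ler_pM2l ?lerDl.
apply: (sqr_dist_le_kl (p := fun j => r 0 j) (q := fun i => \sum_j B i j)).
- by move=> j; rewrite r0 le1.
- by move=> j; rewrite rS row_le1.
- by rewrite r1.
Qed.

End SinkhornStep.

(** * Limits of real and matrix-valued functions *)

Section Limits.
Variable R : realType.

Lemma cvgr_sum (T : Type) (F : set_system T) (I : finType) (f : I -> T -> R)
    (l : I -> R) : Filter F -> (forall i, f i x @[x --> F] --> l i) ->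
  \sum_i f i x @[x --> F] --> \sum_i l i.
Proof. by move=> FF h; apply: cvg_big => //; exact: add_continuous. Qed.

Lemma cvgr_unique (T : Type) (F : set_system T) {PF : ProperFilter F}
    (f : T -> R) (a b : R) :
  f x @[x --> F] --> a -> f x @[x --> F] --> b -> a = b.
Proof. by move=> fa fb; rewrite -(cvg_lim _ fa)// -(cvg_lim _ fb). Qed.

Lemma cvg_mxP (T : Type) (F : set_system T) (n m : nat) (f : T -> 'M[R]_(n, m))
    (M : 'M[R]_(n, m)) : Filter F ->
  f x @[x --> F] --> M <-> forall i j, f x i j @[x --> F] --> M i j.
Proof.
move=> FF; split => [fM i j|fM].
  exact: (cvg_comp _ _ fM (@coord_continuous R n m i j M)).
move=> A [P MP PA]; rewrite nbhs_simpl/=.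
have : \forall x \near F, forall i j, P i j (f x i j).
  apply: filter_forall => i; apply: filter_forall => j.
  exact: fM (MP i j).
by apply: filterS => x Px; exact: PA.
Qed.

Lemma cvg_sqr_dist_le (T : Type) (F : set_system T) (f g : T -> R) (l : R) :
  Filter F -> (\forall x \near F, (f x - l) ^+ 2 <= g x) ->
  g x @[x --> F] --> 0 -> f x @[x --> F] --> l.
Proof.
move=> FF fg g0; apply/cvgrPdist_le => e e0.
have e2 : 0 < e ^+ 2 by rewrite exprn_gt0.
near=> x.
have fx : (f x - l) ^+ 2 <= g x by near: x.
have gx : `|g x| <= e ^+ 2 by near: x; exact: cvgr0_norm_le.
rewrite distrC -(ler_pXn2r (n := 2))// ?nnegrE ?(ltW e0)// real_normK ?num_real//.
exact: le_trans fx (le_trans (ler_norm _) gx).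
Unshelve. all: by end_near. Qed.

Lemma cvg_logmean (T : Type) (F : set_system T) (f : T -> R) (a : R) :
  Filter F -> 0 < a -> f x @[x --> F] --> a ->
  logmean (f x) a @[x --> F] --> a.
Proof.
move=> FF a0 fa; apply/cvgrPdist_le => e e0; near=> x.
have fx0 : 0 < f x by near: x; exact: cvgr_gt fa _ a0.
rewrite distrC; apply: le_trans (logmean_dist fx0 a0) _.
by rewrite distrC; near: x; exact: cvgr_dist_le fa _ e0.
Unshelve. all: by end_near. Qed.

Lemma cvgn_sqr_dist_le (u g : nat -> R) :
  (forall k l, (u k - u l) ^+ 2 <= g k + g l) -> g @ \oo --> 0 -> cvgn u.
Proof.
move=> ug g0; apply: cauchy_cvg; apply: cauchy_exP => e e0.
(* Two terms of [g], each at most $e^2/4$, stay strictly below $e^2$ together. *)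
have e2 : 0 < e ^+ 2 / 4 by rewrite divr_gt0// exprn_gt0.
have [N _ gN] := cvgr0_norm_le g g0 _ e2.
exists (u N); exists N => // k /= Nk; rewrite /ball/= distrC.
rewrite -(ltr_pXn2r (n := 2))// ?nnegrE ?(ltW e0)// real_normK ?num_real//.
have := gN k Nk; have := gN N (leqnn N); have := ug k N.
have := ler_norm (g k); have := ler_norm (g N); move: e2 => /=; lra.
Qed.

End Limits.

Section SinkhornConvergence.
Variables (R : realType) (n m : nat) (r : 'rV[R]_n) (c : 'rV[R]_m).
Variable A : 'M[R]_(n, m).
Hypotheses (n0 : (0 < n)%N) (m0 : (0 < m)%N).
Hypotheses (r_prob : pos_prob r) (c_prob : pos_prob c).
Hypothesis A0 : forall i j, 0 < A i j.

(** The shift by one skips [A] itself: after a full step the column sums are exactly [c] and the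
    total is 1. *)
Let u k := sinkhorn_seq r c A k.+1.

Let seq_gt0 k : forall i j, 0 < sinkhorn_seq r c A k i j.
Proof. by elim: k => [//|k IH]; exact: step_gt0. Qed.

Let u_gt0 k : forall i j, 0 < u k i j.
Proof. exact: seq_gt0. Qed.

Let u_col k : forall j, \sum_i u k i j = c 0 j.
Proof. exact: step_col_sum. Qed.

Let u_total k : \sum_i \sum_j u k i j = 1.
Proof.
by rewrite exchange_big/=; under eq_bigr do rewrite u_col; case: c_prob.
Qed.

Let u_le1 k i j : u k i j <= 1.
Proof. exact: entry_le1. Qed.

Let u_scaling k : is_scaling A (u k).
Proof.
rewrite /u; elim: k.+1 => [|l IH] i k' j l'; first by rewrite !subrr.
have := is_scaling_step r_prob c_prob (seq_gt0 l) i k' j l'.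
by have := IH i k' j l'; rewrite /=; lra.
Qed.

Let pot k := potential r c (u k).

Let pot_row k i : (r 0 i - \sum_j u k i j) ^+ 2 <= 4 * (pot k.+1 - pot k).
Proof. exact: potential_step. Qed.

Let pot_homo : {homo pot : k l / (k <= l)%N >-> k <= l}.
Proof.
apply/nondecreasing_seqP => k.
have := le_trans (sqr_ge0 _) (pot_row k (Ordinal n0)).
by rewrite pmulr_rge0// subr_ge0.
Qed.

Let potE_le0 k i j : r 0 i * c 0 j * ln (u k i j) <= 0.
Proof.
case: r_prob c_prob => r0 _ [c0 _].
by rewrite mulr_ge0_le0 ?ln_le0// mulr_ge0 ?ltW.
Qed.

(** All terms of the potential are nonpositive, so it lies below each single one. *)
Let pot_le k i j : pot k <= r 0 i * c 0 j * ln (u k i j).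
Proof.
rewrite /pot /potential (bigD1 i)//= (bigD1 j)//= -addrA gerDl.
rewrite -oppr_ge0 opprD addr_ge0// -sumrN; apply: sumr_ge0 => p _.
  by rewrite oppr_ge0.
by rewrite -sumrN; apply: sumr_ge0 => q _; rewrite oppr_ge0.
Qed.

Let pot_cvg : cvgn pot.
Proof.
apply: nondecreasing_is_cvgn => //; exists 0 => _ [k _ <-].
by apply: le_trans (pot_le k (Ordinal n0) (Ordinal m0)) _; exact: potE_le0.
Qed.

(** The squared row defect is at most four times an increment of the convergent sequence [pot]. *)
Let u_row i : \sum_j u k i j @[k --> \oo] --> r 0 i.
Proof.
apply: (@cvg_sqr_dist_le _ _ _ _ (fun k => 4 * (pot k.+1 - pot k))).
  by apply: nearW => k; rewrite -sqrrN opprB.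
rewrite -(mulr0 4) -(subrr (limn pot)); apply: cvgMr; apply: cvgB => //.
by rewrite (cvg_shiftS pot).
Qed.

Let u_lower_bound : exists2 k : R, 0 < k & forall l i j, k <= u l i j.
Proof.
case: (r_prob) (c_prob) => r0 _ [c0 _].
have rc0 i j : 0 < r 0 i * c 0 j by rewrite mulr_gt0.
(* Monotonicity and [pot_le] give $\ln u_{ij}\ge \mathrm{pot}_0/(r_ic_j)$. As $\mathrm{pot}_0\le 0$,
   replacing the inverse weight by the sum of all of them only lowers the bound and makes it
   uniform. *)
exists (expR (pot 0%N * \sum_i \sum_j (r 0 i * c 0 j)^-1)); first exact: expR_gt0.
move=> l i j; rewrite -[leRHS]lnK ?posrE// ler_expR.
apply: le_trans (_ : pot 0%N * (r 0 i * c 0 j)^-1 <= _); last first.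
  rewrite ler_pdivrMr// mulrC; apply: le_trans (pot_le l i j).
  exact: pot_homo.
apply: ler_wnM2l; first exact: le_trans (pot_le 0 i j) (potE_le0 _ _ _).
rewrite (bigD1 i)//= (bigD1 j)//= -addrA lerDl addr_ge0//.
  by apply: sumr_ge0 => q _; rewrite invr_ge0 ltW.
by apply: sumr_ge0 => p _; apply: sumr_ge0 => q _; rewrite invr_ge0 ltW.
Qed.

(** Any two iterates are scalings of the same [A] with equal column sums, so [scaling_dist] with
    [w = 0] bounds their distance by row defects alone, which tend to 0. *)
Lemma sinkhorn_cvg : exists B, [/\ coupling r c B, is_scaling A B &
  sinkhorn_seq r c A @ \oo --> B].
Proof.
have [kap kap0 kap_le] := u_lower_bound.
have u_cvg i j : cvgn (fun k => u k i j).
  pose g k := \sum_i `|\sum_j u k i j - r 0 i| * - ln kap.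
  have lnk : 0 <= - ln kap.
    rewrite oppr_ge0 ln_le0//.
    by rewrite (le_trans (kap_le 0 i j)).
  apply: (@cvgn_sqr_dist_le _ _ g).
    move=> k l.
    apply: (@le_trans _ _ (\sum_p \sum_q (u k p q - u l p q) ^+ 2)).
      rewrite (bigD1 i)//= (bigD1 j)//= -addrA lerDl addr_ge0//.
        by apply: sumr_ge0 => q _; exact: sqr_ge0.
      by apply: sumr_ge0 => p _; apply: sumr_ge0 => q _; exact: sqr_ge0.
    apply: le_trans (scaling_dist (w := fun _ _ => 0) (Ordinal n0) (Ordinal m0)
      kap0 _ _ _ _) _.
    - by move=> p q; rewrite kap_le u_le1.
    - by move=> p q; rewrite kap_le u_le1.
    - by rewrite !u_total.
    - move=> p q s t /=; have := u_scaling k p q s t; have := u_scaling l p q s t.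
      by rewrite !subr0; lra.
    rewrite normr0 [X in X + _ + _]big1; last by move=> p _; rewrite big1.
    rewrite [X in _ + X]big1; last by move=> q _; rewrite !u_col subrr normr0 mul0r.
    rewrite !add0r addr0 /g -big_split/=; apply: ler_sum => p _.
    rewrite -mulrDl ler_wpM2r// -[X in `|X|](subrKA (r 0 p)).
    by rewrite -[X in _ <= _ + X]normrN opprB ler_normD.
  rewrite -(_ : \sum_(i < n) `|r 0 i - r 0 i| * - ln kap = 0); last first.
    by apply: big1 => p _; rewrite subrr normr0 mul0r.
  apply: cvgr_sum => p; apply: cvgMl; apply: cvg_norm; apply: cvgB => //.
  exact: cvg_cst.
pose B : 'M[R]_(n, m) := \matrix_(i, j) limn (fun k => u k i j).
have uB i j : u k i j @[k --> \oo] --> B i j by rewrite mxE; exact: u_cvg.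
have B0 i j : 0 < B i j.
  apply: lt_le_trans kap0 _; rewrite mxE; apply: limr_ge => //.
  by apply: nearW => k; exact: kap_le.
exists B; split; first split => //.
- move=> i; apply/esym; refine (cvgr_unique (@u_row i) _).
  by apply: cvgr_sum => j; exact: uB.
- move=> j; refine (cvgr_unique (F := \oo) (f := fun k => \sum_i u k i j) _ _).
    by apply: cvgr_sum => i; exact: uB.
  by under eq_cvg do rewrite u_col; exact: cvg_cst.
- move=> i k j l.
  have lnB p q : ln (u k p q) - ln (A p q) @[k --> \oo] --> ln (B p q) - ln (A p q).
    apply: cvgB; last exact: cvg_cst.
    by apply: continuous_cvg; [exact: continuous_ln|exact: uB].
  refine (cvgr_unique (cvgD (lnB i j) (lnB k l)) _).
  under eq_cvg => k' do rewrite /= (u_scaling k' i k j l).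
  exact: cvgD.
rewrite -(cvg_shiftS (sinkhorn_seq r c A)).
by apply/cvg_mxP.
Qed.

Lemma sinkhorn_limitP : coupling r c (sinkhorn_limit r c A) /\
  is_scaling A (sinkhorn_limit r c A).
Proof.
have [B [cB sB uB]] := sinkhorn_cvg.
by rewrite /sinkhorn_limit (cvg_lim _ uB).
Qed.

End SinkhornConvergence.

(** * The linearised scaling equations *)

Section ClosedClasses.
Variables (R : realType) (X : Type) (D : set X).

(** Covers both uses of the explicit derivative formula: functions continuous at 0 (with [D] the
    singleton of 0) and the functions in [Phi_rational]. *)
Record inverse_closed (P : (X -> R) -> Prop) : Prop := InverseClosed {
  closed_cst : forall a, P (fun=> a);
  closedD : forall f g, P f -> P g -> P (fun x => f x + g x);
  closedM : forall f g, P f -> P g -> P (fun x => f x * g x);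
  closedV : forall f, P f -> (forall x, D x -> f x != 0) ->
    P (fun x => (f x)^-1) }.

Variable P : (X -> R) -> Prop.
Hypothesis PC : inverse_closed P.

Lemma closed_sum (I : Type) (s : seq I) (f : I -> X -> R) :
  (forall i, P (f i)) -> P (fun x => \sum_(i <- s) f i x).
Proof.
move=> Pf; elim: s => [|i s IH].
  by under eq_fun do rewrite big_nil; exact: closed_cst.
by under eq_fun do rewrite big_cons; exact: closedD.
Qed.

Lemma closed_prod (I : Type) (s : seq I) (f : I -> X -> R) :
  (forall i, P (f i)) -> P (fun x => \prod_(i <- s) f i x).
Proof.
move=> Pf; elim: s => [|i s IH].
  by under eq_fun do rewrite big_nil; exact: closed_cst.
by under eq_fun do rewrite big_cons; exact: closedM.
Qed.

Lemma closed_det p (A : X -> 'M[R]_p) :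
  (forall i j, P (fun x => A x i j)) -> P (fun x => \det (A x)).
Proof.
move=> PA; apply: closed_sum => s; apply: closedM => //; first exact: closed_cst.
by apply: closed_prod => i; exact: PA.
Qed.

Lemma closed_adj p (A : X -> 'M[R]_p) :
  (forall i j, P (fun x => A x i j)) ->
  forall i j, P (fun x => (\adj (A x)) i j).
Proof.
move=> PA i j; under eq_fun do rewrite mxE /cofactor.
apply: closedM => //; first exact: closed_cst.
by apply: closed_det => k l; under eq_fun do rewrite !mxE; exact: PA.
Qed.

End ClosedClasses.

(** * The grounded Laplacian of a weighted complete bipartite graph *)

Section GroundedLaplacian.
Variables (R : realType) (n m : nat) (j0 : 'I_m).
Implicit Types (B W : 'M[R]_(n, m)) (z V : 'rV[R]_(n + m)).

(** Unsigned, since the potentials of row and column are added; left indices are row vertices, right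
    indices column vertices. *)
Definition incidence (i : 'I_n) (j : 'I_m) (a : 'I_(n + m)) : R :=
  (a == lshift m i)%:R + (a == rshift n j)%:R.

(** Grounding at [j0] removes the freedom to add a constant to all row potentials and subtract it
    from all column potentials. *)
Definition ground (a : 'I_(n + m)) : R := (a == rshift n j0)%:R.

Definition laplacian B : 'M[R]_(n + m) := \matrix_(a, b)
  (\sum_i \sum_j B i j * (incidence i j a * incidence i j b)
   + ground a * ground b).

Lemma sum_mul_delta (I : finType) (f : I -> R) (k : I) :
  \sum_i f i * (i == k)%:R = f k.
Proof.
rewrite (bigD1 k)//= eqxx mulr1 big1 ?addr0// => i /negbTE ->.
by rewrite mulr0.
Qed.

Lemma sum_mul_incidence (z : 'I_(n + m) -> R) i j :
  \sum_a z a * incidence i j a = z (lshift m i) + z (rshift n j).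
Proof. by under eq_bigr do rewrite mulrDr; rewrite big_split/= !sum_mul_delta. Qed.

Lemma sum_mul_ground (z : 'I_(n + m) -> R) :
  \sum_a z a * ground a = z (rshift n j0).
Proof. exact: sum_mul_delta. Qed.

Lemma mulmx_laplacian z B b :
  (z *m laplacian B) 0 b =
  \sum_i \sum_j B i j * (z 0 (lshift m i) + z 0 (rshift n j)) * incidence i j b
  + z 0 (rshift n j0) * ground b.
Proof.
rewrite mxE; under eq_bigr do rewrite mxE mulrDr mulr_sumr mulrA.
rewrite big_split/= -mulr_suml sum_mul_ground; congr (_ + _).
rewrite exchange_big/=; apply: eq_bigr => i _.
under eq_bigr do rewrite mulr_sumr.
rewrite exchange_big/=; apply: eq_bigr => j _.
rewrite -(sum_mul_incidence (fun a => z 0 a)) mulr_sumr mulr_suml.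
by apply: eq_bigr => a _; ring.
Qed.

(** The quadratic form is $\sum B_{ij}(z_i+z_j)^2+z_{j_0}^2$. If it vanishes, then $z_{j_0}=0$
    forces all row coordinates to be 0, and then any row forces all column coordinates to be 0. *)
Lemma det_laplacian B : (0 < n)%N -> (forall i j, 0 < B i j) ->
  \det (laplacian B) != 0.
Proof.
move=> n0 B0; apply/det0P => -[z z0 zK]; case/negP: z0; apply/eqP.
have quad_form : \sum_b (z *m laplacian B) 0 b * z 0 b =
    \sum_i \sum_j B i j * (z 0 (lshift m i) + z 0 (rshift n j)) ^+ 2
    + z 0 (rshift n j0) ^+ 2.
  under eq_bigr do rewrite mulmx_laplacian mulrDl mulr_suml.
  rewrite big_split/= exchange_big/=; congr (_ + _); last first.
    rewrite expr2 -[in RHS](sum_mul_ground (fun a => z 0 a)) mulr_sumr.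
    by apply: eq_bigr => b _; rewrite sum_mul_ground; ring.
  apply: eq_bigr => i _; under eq_bigr do rewrite mulr_suml.
  rewrite exchange_big/=; apply: eq_bigr => j _.
  rewrite expr2 mulrA -[in RHS](sum_mul_incidence (fun a => z 0 a)) mulr_sumr.
  by apply: eq_bigr => b _; rewrite sum_mul_incidence; ring.
have /esym/eqP : 0 = \sum_i \sum_j
    B i j * (z 0 (lshift m i) + z 0 (rshift n j)) ^+ 2 + z 0 (rshift n j0) ^+ 2.
  by rewrite -quad_form zK big1// => b _; rewrite mxE mul0r.
have sq0 i j : 0 <= B i j * (z 0 (lshift m i) + z 0 (rshift n j)) ^+ 2.
  by rewrite mulr_ge0 ?sqr_ge0// ltW.
have sq0s i : 0 <= \sum_j B i j * (z 0 (lshift m i) + z 0 (rshift n j)) ^+ 2.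
  exact: sumr_ge0.
rewrite paddr_eq0 ?sqr_ge0 ?sumr_ge0// => /andP[+ zj0].
rewrite psumr_eq0// => /allP/= zz.
have {}zz i j : z 0 (lshift m i) + z 0 (rshift n j) = 0.
  have := zz i (mem_index_enum _); rewrite psumr_eq0// => /allP/= /(_ j).
  move=> /(_ (mem_index_enum _)); rewrite mulf_eq0 gt_eqF ?B0//= sqrf_eq0.
  by move/eqP.
have zl i : z 0 (lshift m i) = 0.
  by have := zz i j0; move: zj0; rewrite sqrf_eq0 => /eqP ->; rewrite addr0.
apply/rowP => a; rewrite mxE; case: (split_ordP a) => [i ->//|j ->].
by have := zz (Ordinal n0) j; rewrite zl add0r.
Qed.

(** Cramer's rule, written out so that the entries are visibly rational in [B] and [V]. *)
Definition solve_laplacian B V : 'rV[R]_(n + m) := \row_a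
  \sum_b V 0 b * ((\det (laplacian B))^-1 * \adj (laplacian B) b a).

Lemma solve_laplacianP B z V : (0 < n)%N -> (forall i j, 0 < B i j) ->
  z *m laplacian B = V -> z = solve_laplacian B V.
Proof.
move=> n0 B0 <-; have dK := det_laplacian n0 B0.
transitivity ((\det (laplacian B))^-1 *: (z *m laplacian B *m \adj (laplacian B))).
  by rewrite -mulmxA mul_mx_adj mul_mx_scalar scalerA mulVf// scale1r.
apply/rowP => a; rewrite !mxE mulr_sumr; apply: eq_bigr => b _; ring.
Qed.

(** The part of the prescribed marginal change [V] that the entrywise product of [B] and [W] does
    not already produce; the potentials must supply it. *)
Definition marginals_defect V B W : 'rV[R]_(n + m) := \row_a
  (V 0 a - \sum_i \sum_j B i j * W i j * incidence i j a).

(* The derivative of the scaled matrix [B] when the logarithm of the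
   unscaled matrix moves in direction [W] and the marginals in direction [V]. *)
Definition scaling_deriv V B W : 'M[R]_(n, m) :=
  let z := solve_laplacian B (marginals_defect V B W) in
  \matrix_(i, j) (B i j * (W i j + (z 0 (lshift m i) + z 0 (rshift n j)))).

Lemma closed_scaling_deriv (X : Type) (D : set X) (P : (X -> R) -> Prop)
    (V : 'rV[R]_(n + m)) (B W : X -> 'M[R]_(n, m)) :
  inverse_closed D P -> (0 < n)%N -> (forall x, D x -> forall i j, 0 < B x i j) ->
  (forall i j, P (fun x => B x i j)) -> (forall i j, P (fun x => W x i j)) ->
  forall i j, P (fun x => scaling_deriv V (B x) (W x) i j).
Proof.
move=> PC n0 B0 PB PW.
have PL a b : P (fun x => laplacian (B x) a b).
  under eq_fun do rewrite mxE.
  apply: (closedD PC); last exact: (closed_cst PC).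
  apply: (closed_sum PC) => i; apply: (closed_sum PC) => j.
  by apply: (closedM PC) => //; exact: (closed_cst PC).
have Pz a : P (fun x =>
    solve_laplacian (B x) (marginals_defect V (B x) (W x)) 0 a).
  under eq_fun do rewrite mxE.
  apply: (closed_sum PC) => b; apply: (closedM PC); last first.
    apply: (closedM PC); last exact: (closed_adj PC).
    apply: (closedV PC); first exact: (closed_det PC).
    by move=> x Dx; apply: det_laplacian => //; exact: B0.
  under eq_fun do rewrite mxE -mulN1r.
  apply: (closedD PC); first exact: (closed_cst PC).
  apply: (closedM PC); first exact: (closed_cst PC).
  apply: (closed_sum PC) => k; apply: (closed_sum PC) => l.
  by apply: (closedM PC); [exact: (closedM PC)|exact: (closed_cst PC)].
move=> i j; under eq_fun do rewrite mxE.
apply: (closedM PC) => //; apply: (closedD PC) => //.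
exact: (closedD PC).
Qed.

Lemma marginals_incidence B (r : 'rV[R]_n) (c : 'rV[R]_m) :
  (forall i, \sum_j B i j = r 0 i) -> (forall j, \sum_i B i j = c 0 j) ->
  forall a, \sum_i \sum_j B i j * incidence i j a = row_mx r c 0 a.
Proof.
move=> Br Bc a; under eq_bigr do under eq_bigr do rewrite mulrDr.
under eq_bigr do rewrite big_split/= -mulr_suml Br.
rewrite big_split/=; case: (split_ordP a) => [i ->|j ->].
  rewrite row_mxEl [X in _ + X]big1 ?addr0.
    under eq_bigr do rewrite eq_lshift eq_sym.
    exact: sum_mul_delta.
  by move=> k _; rewrite big1// => l _; rewrite eq_lrshift mulr0.
rewrite row_mxEr big1 ?add0r; last by move=> k _; rewrite eq_rlshift mulr0.
rewrite exchange_big/=.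
under eq_bigr do rewrite -mulr_suml Bc eq_rshift eq_sym.
exact: sum_mul_delta.
Qed.

(* Replacing [B] by its entrywise logarithmic mean with [B'] makes the
   first-order formula exact for finite increments. *)
Lemma scaling_increment B B' W (v : 'rV[R]_n) (w : 'rV[R]_m) : (0 < n)%N ->
  (forall i j, 0 < B i j) -> (forall i j, 0 < B' i j) ->
  separable (fun i j => ln (B' i j) - ln (B i j) - W i j) ->
  (forall i, \sum_j (B' - B) i j = v 0 i) ->
  (forall j, \sum_i (B' - B) i j = w 0 j) ->
  B' - B = scaling_deriv (row_mx v w)
    (\matrix_(i, j) logmean (B' i j) (B i j)) W.
Proof.
move=> n0 B0 B'0 sep Dr Dc; set L := \matrix_(i, j) _.
have L0 i j : 0 < L i j by rewrite mxE logmean_gt0.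
pose e i j := ln (B' i j) - ln (B i j) - W i j.
have DE i j : (B' - B) i j = L i j * (W i j + e i j).
  by rewrite !mxE /e [W i j + _]addrC subrK -sub_logmean.
pose i0 := Ordinal n0.
(* The potentials are normalised to vanish at the vertex [j0], so the grounding term contributes
   nothing. *)
pose z : 'rV[R]_(n + m) :=
  row_mx (\row_i e i j0) (\row_j (e i0 j - e i0 j0)).
have ze i j : z 0 (lshift m i) + z 0 (rshift n j) = e i j.
  have : e i j + e i0 j0 = e i j0 + e i0 j by exact: sep.
  by rewrite row_mxEl row_mxEr !mxE; lra.
have zE : z = solve_laplacian L (marginals_defect (row_mx v w) L W).
  apply: solve_laplacianP => //; apply/rowP => a; rewrite mulmx_laplacian.
  rewrite [RHS]mxE -(marginals_incidence Dr Dc) row_mxEr mxE subrr mul0r addr0.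
  rewrite -sumrB; apply: eq_bigr => i _; rewrite -sumrB; apply: eq_bigr => j _.
  by rewrite ze DE; ring.
by apply/matrixP => i j; rewrite DE [RHS]mxE -zE ze.
Qed.

Lemma scaling_derivZ (h : R) V B W :
  scaling_deriv (h *: V) B (h *: W) = h *: scaling_deriv V B W.
Proof.
have defZ a : marginals_defect (h *: V) B (h *: W) 0 a =
    h * marginals_defect V B W 0 a.
  rewrite !mxE mulrBr; congr (_ - _); rewrite mulr_sumr; apply: eq_bigr => i _.
  by rewrite mulr_sumr; apply: eq_bigr => j _; rewrite mxE; ring.
have solZ a : solve_laplacian B (marginals_defect (h *: V) B (h *: W)) 0 a =
    h * solve_laplacian B (marginals_defect V B W) 0 a.
  rewrite mxE [in RHS]mxE mulr_sumr; apply: eq_bigr => b _.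
  by rewrite defZ mulrA.
apply/matrixP => i j; rewrite [LHS]mxE [RHS]mxE [in RHS]mxE !solZ.
by rewrite [(h *: W) i j]mxE; ring.
Qed.

End GroundedLaplacian.

Lemma near_lower_bound (R : realType) (T : Type) (F : set_system T)
    (I : finType) (f : I -> T -> R) (l : I -> R) : Filter F ->
  (forall i, 0 < l i) -> (forall i, f i x @[x --> F] --> l i) ->
  exists2 q : R, 0 < q & \forall x \near F, forall i, q <= f i x.
Proof.
move=> FF l0 fl; pose q := \big[Num.min/1]_i (l i / 2).
exists q; first by apply: lt_bigmin => // i _; rewrite divr_gt0.
apply: filter_forall => i; apply: (cvgr_ge (l i)); first exact: fl.
apply: le_lt_trans (bigmin_le _ i (fun i => l i / 2)) _.
by have := l0 i; lra.
Qed.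

(** * Continuity and derivatives of Phi *)

Section PhiRegularity.
Variables (R : realType) (n m : nat) (lam : R).
Hypotheses (n0 : (0 < n)%N) (m0 : (0 < m)%N).

Local Notation X := ('M[R]_(n, m) * ('rV[R]_n * 'rV[R]_m))%type.
Local Notation D := (@Phi_dom R n m).
Local Notation T := (@Phi_tangent R n m).
Local Notation Phi := (@Phi R n m lam).
Implicit Types (x v : X).

Lemma PhiP x : D x -> coupling x.2.1 x.2.2 (Phi x) /\
  is_scaling (mx_pow lam x.1) (Phi x).
Proof.
move=> [M0 [rP cP]]; apply: sinkhorn_limitP => // i j.
by rewrite mxE powR_gt0.
Qed.

Lemma Phi_gt0 x i j : D x -> 0 < Phi x i j.
Proof. by move=> /PhiP[[]]. Qed.

Lemma Phi_le1 x i j : D x -> Phi x i j <= 1.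
Proof.
move=> Dx; have [cpl _] := PhiP Dx.
by case: Dx => _ [rP _]; exact: coupling_le1 cpl.
Qed.

(** Entrywise powers multiply logarithms by [lam], which gives the perturbation [w] for
    [scaling_dist]. *)
Lemma Phi_separable x y : D x -> D y -> separable (fun i j =>
  ln (Phi y i j) - ln (Phi x i j) - lam * (ln (y.1 i j) - ln (x.1 i j))).
Proof.
move=> Dx Dy; have [_ sx] := PhiP Dx; have [_ sy] := PhiP Dy.
have := separableB sy sx; congr separable; apply/funext => i; apply/funext => j.
rewrite !mxE !ln_powR; move: (ln (Phi y i j)) (ln (Phi x i j)) => b a.
by move: (ln (y.1 i j)) (ln (x.1 i j)) => d c; ring.
Qed.

Section Coordinates.
Variables (U : Type) (F : set_system U) (f : U -> X) (x : X).
Hypotheses (FF : Filter F) (fx : f u @[u --> F] --> x).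

Lemma cvg_coord1 i j : (f u).1 i j @[u --> F] --> x.1 i j.
Proof.
have fx1 : (f u).1 @[u --> F] --> x.1 by apply: cvg_comp fx _; exact: cvg_fst.
by move/cvg_mxP : fx1; apply.
Qed.

Lemma cvg_coord21 i : (f u).2.1 0 i @[u --> F] --> x.2.1 0 i.
Proof.
have fx2 : (f u).2 @[u --> F] --> x.2 by apply: cvg_comp fx _; exact: cvg_snd.
have fx21 : (f u).2.1 @[u --> F] --> x.2.1 by apply: cvg_comp fx2 _; exact: cvg_fst.
by move/cvg_mxP : fx21; apply.
Qed.

Lemma cvg_coord22 j : (f u).2.2 0 j @[u --> F] --> x.2.2 0 j.
Proof.
have fx2 : (f u).2 @[u --> F] --> x.2 by apply: cvg_comp fx _; exact: cvg_snd.
have fx22 : (f u).2.2 @[u --> F] --> x.2.2 by apply: cvg_comp fx2 _; exact: cvg_snd.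
by move/cvg_mxP : fx22; apply.
Qed.

Lemma cvg_ln_coord1 i j : 0 < x.1 i j ->
  ln ((f u).1 i j) @[u --> F] --> ln (x.1 i j).
Proof.
by move=> M0; apply: continuous_cvg; [exact: continuous_ln|exact: cvg_coord1].
Qed.

End Coordinates.

(** Near [x] the constants in [scaling_lower_bound] can be chosen uniformly. *)
Lemma Phi_near_ge x : D x -> exists2 k : R, 0 < k &
  \forall y \near within D (nbhs x), forall i j, k <= Phi y i j.
Proof.
move=> [M0 [[r0 _] [c0 _]]].
have FF : Filter (within D (nbhs x)) by exact: within_filter.
have idx : id y @[y --> within D (nbhs x)] --> x by exact: cvg_within.
have cvg1 (i : 'I_n) (j : 'I_m) : 
    (y : X).1 i j @[y --> within D (nbhs x)] --> x.1 i j.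
  exact: (cvg_coord1 FF idx).
have powE i j : mx_pow lam y.1 i j @[y --> within D (nbhs x)] -->
    mx_pow lam x.1 i j.
  have lnc : expR (lam * ln ((y : X).1 i j)) @[y --> within D (nbhs x)] -->
      expR (lam * ln (x.1 i j)).
    apply: continuous_cvg; first exact: continuous_expR.
    by apply: cvgMr; exact: (cvg_ln_coord1 FF idx).
  rewrite mxE /powR gt_eqF//; apply: cvg_trans lnc.
  apply: near_eq_cvg; near=> y; rewrite mxE /powR gt_eqF//.
  near: y; exact: (cvgr_gt _ (cvg1 i j)).
have mx0 i j : 0 < mx_pow lam x.1 i j by rewrite mxE powR_gt0.
have [a a0 aP] : exists2 a : R, 0 < a & \forall y \near within D (nbhs x),
    forall p : 'I_n * 'I_m, a <= mx_pow lam y.1 p.1 p.2.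
  by apply: (near_lower_bound FF
    (l := fun p : 'I_n * 'I_m => mx_pow lam x.1 p.1 p.2)).
(* The upper bound on the entries is obtained as a lower bound [b] on their inverses, hence [b^-1]
   below. *)
have [b b0 bP] : exists2 b : R, 0 < b & \forall y \near within D (nbhs x),
    forall p : 'I_n * 'I_m, b <= (mx_pow lam y.1 p.1 p.2)^-1.
  apply: (near_lower_bound FF
    (l := fun p : 'I_n * 'I_m => (mx_pow lam x.1 p.1 p.2)^-1)).
    by move=> p; rewrite invr_gt0.
  by move=> p; apply: cvgV; [rewrite gt_eqF|exact: powE].
have [s s0 sP] := near_lower_bound FF r0 (cvg_coord21 FF idx).
have [t t0 tP] := near_lower_bound FF c0 (cvg_coord22 FF idx).
exists ((a / b^-1) ^+ 2 * (s * t)).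
  by rewrite mulr_gt0 ?mulr_gt0 ?exprn_gt0 ?divr_gt0 ?invr_gt0.
near=> y => i j.
have Dy : D y by near: y; exact: near_withinT.
have [cpl scl] := PhiP Dy; have [My0 [rP _]] := Dy.
apply: le_trans (scaling_lower_bound (b := b^-1) rP cpl scl a0 _ i j).
  rewrite ler_wpM2l ?sqr_ge0// ler_pM ?(ltW s0) ?(ltW t0)//.
    by move: i; near: y; exact: sP.
  by move: j; near: y; exact: tP.
move=> k l; apply/andP; split.
  by have : forall p : 'I_n * 'I_m, a <= mx_pow lam y.1 p.1 p.2;
    [near: y; exact: aP|move/(_ (k, l))].
have : forall p : 'I_n * 'I_m, b <= (mx_pow lam y.1 p.1 p.2)^-1.
  by near: y; exact: bP.
move=> /(_ (k, l))/= bM; have My : 0 < mx_pow lam y.1 k l by rewrite mxE powR_gt0.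
by rewrite -[leLHS]invrK lef_pV2 ?posrE ?invr_gt0.
Unshelve. all: by end_near. Qed.

(** With the uniform lower bound [k], [scaling_dist] bounds the squared distance by [g], whose terms
    all contain a factor tending to 0. *)
Lemma Phi_continuous x i j : D x ->
  Phi y i j @[y --> within D (nbhs x)] --> Phi x i j.
Proof.
move=> Dx; have [k k0 kP] := Phi_near_ge Dx; have [M0 _] := Dx.
have FF : Filter (within D (nbhs x)) by exact: within_filter.
have idx : id y @[y --> within D (nbhs x)] --> x by exact: cvg_within.
pose w (y : X) (i : 'I_n) (j : 'I_m) := lam * (ln (y.1 i j) - ln (x.1 i j)).
pose i0 := Ordinal n0; pose j0 := Ordinal m0.
have kx : forall i j, k <= Phi x i j.
  by move: (kP); rewrite near_withinE => /nbhs_singleton; exact.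
pose g (y : X) := \sum_i \sum_j `|w y i j|
  + \sum_i `|y.2.1 0 i - x.2.1 0 i| * (`|w y i j0| - ln k)
  + \sum_j `|y.2.2 0 j - x.2.2 0 j| * (`|w y i0 j| - ln k).
have total y : D y -> \sum_i \sum_j Phi y i j = 1.
  by move=> Dy; have [[_ Br _] _] := PhiP Dy; under eq_bigr do rewrite Br;
    case: Dy => _ [[]].
apply: (cvg_sqr_dist_le (g := g)).
  near=> y.
  have Dy : D y by near: y; exact: near_withinT.
  have ky : forall i j, k <= Phi y i j by near: y; exact: kP.
  have [[_ Br Bc] _] := PhiP Dy; have [[_ Br' Bc'] _] := PhiP Dx.
  apply: le_trans (le_trans (scaling_dist (w := w y) i0 j0 k0 _ _ _
    (Phi_separable Dx Dy)) _).
  - rewrite (bigD1 i)//= (bigD1 j)//= -addrA lerDl addr_ge0//.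
      by apply: sumr_ge0 => q _; exact: sqr_ge0.
    by apply: sumr_ge0 => p _; apply: sumr_ge0 => q _; exact: sqr_ge0.
  - by move=> p q; rewrite kx Phi_le1.
  - by move=> p q; rewrite ky Phi_le1.
  - by rewrite !total.
  - apply: lerD; first apply: lerD => //.
      by apply: ler_sum => p _; rewrite Br Br'.
    by apply: ler_sum => q _; rewrite Bc Bc'.
have w0 p q : `|w y p q| @[y --> within D (nbhs x)] --> (0 : R).
  rewrite -(normr0 R) -(mulr0 lam) -(subrr (ln (x.1 p q))).
  apply: cvg_norm; apply: cvgMr; apply: cvgB; last exact: cvg_cst.
  exact: (cvg_ln_coord1 FF idx).
rewrite (_ : 0 = \sum_(p < n) \sum_(q < m) 0
    + \sum_(p < n) 0 * (0 - ln k) + \sum_(q < m) 0 * (0 - ln k)); last first.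
  by rewrite !big1 ?addr0// => p _; rewrite ?mul0r// big1.
apply: cvgD; first apply: cvgD.
- by apply: cvgr_sum => p; apply: cvgr_sum => q; exact: w0.
- apply: cvgr_sum => p; apply: cvgM; last first.
    by apply: cvgB; [exact: w0|exact: cvg_cst].
  rewrite -(normr0 R) -(subrr (x.2.1 0 p)); apply: cvg_norm.
  by apply: cvgB; [exact: (cvg_coord21 FF idx)|exact: cvg_cst].
- apply: cvgr_sum => q; apply: cvgM; last first.
    by apply: cvgB; [exact: w0|exact: cvg_cst].
  rewrite -(normr0 R) -(subrr (x.2.2 0 q)); apply: cvg_norm.
  by apply: cvgB; [exact: (cvg_coord22 FF idx)|exact: cvg_cst].
Unshelve. all: by end_near. Qed.

End PhiRegularity.

Section PhiDerivative.
Variables (R : realType) (n m : nat) (lam : R).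
Hypotheses (n0 : (0 < n)%N) (m0 : (0 < m)%N).

Local Notation X := ('M[R]_(n, m) * ('rV[R]_n * 'rV[R]_m))%type.
Local Notation D := (@Phi_dom R n m).
Local Notation T := (@Phi_tangent R n m).
Local Notation Phi := (@Phi R n m lam).
Let j0 : 'I_m := Ordinal m0.

Lemma line_cvg (x v : X) : h *: v + x @[h --> (0 : R)] --> x.
Proof.
rewrite -[X in _ --> X]add0r -(scale0r v).
apply: cvgD; last exact: cvg_cst.
exact: scalel_continuous.
Qed.

(** Positivity is an open condition, and a tangent direction keeps both sums equal to 1. *)
Lemma line_near_dom (x v : X) : D x -> T v ->
  \forall h \near (0 : R), D (h *: v + x).
Proof.
move=> [M0 [[r0 rS] [c0 cS]]] [vr vc].
have lx := @line_cvg x v; have F0 := nbhs_filter (0 : R).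
have c1 i j : (h *: v + x).1 i j @[h --> (0 : R)] --> x.1 i j
  by exact: (cvg_coord1 F0 lx).
have c21 i : (h *: v + x).2.1 0 i @[h --> (0 : R)] --> x.2.1 0 i
  by exact: (cvg_coord21 F0 lx).
have c22 i : (h *: v + x).2.2 0 i @[h --> (0 : R)] --> x.2.2 0 i
  by exact: (cvg_coord22 F0 lx).
near=> h; split; [|split; split].
- move=> i j; move: i j; near: h.
  apply: filter_forall => i; apply: filter_forall => j.
  exact: (cvgr_gt _ (c1 i j)).
- move=> i; move: i; near: h; apply: filter_forall => i.
  exact: (cvgr_gt _ (c21 i)).
- under eq_bigr do rewrite mxE mxE.
  by rewrite big_split/= -mulr_sumr vr mulr0 add0r.
- move=> i; move: i; near: h; apply: filter_forall => i.
  exact: (cvgr_gt _ (c22 i)).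
- under eq_bigr do rewrite mxE mxE.
  by rewrite big_split/= -mulr_sumr vc mulr0 add0r.
Unshelve. all: by end_near. Qed.

Lemma line_cvg_within (x v : X) : D x -> T v ->
  h *: v + x @[h --> (0 : R)] --> within D (nbhs x).
Proof.
move=> Dx Tv A; rewrite /within/= => DA.
have lA : \forall h \near (0 : R), D (h *: v + x) -> A (h *: v + x).
  exact: (@line_cvg x v _ DA).
have lD := line_near_dom Dx Tv.
suff : \forall h \near (0 : R), A (h *: v + x) by [].
near=> h; have : D (h *: v + x) -> A (h *: v + x) by near: h.
by apply; near: h.
Unshelve. all: by end_near. Qed.

Lemma is_derive_cvg (f : X -> R) (x v : X) (l : R) :
  h^-1 *: (f (h *: v + x) - f x) @[h --> 0^'] --> l -> is_derive x v f l.
Proof. by move=> fl; split; [exact: cvgP fl|exact: cvg_lim]. Qed.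

Lemma is_derive_coord1 (x v : X) i j :
  is_derive x v (fun y : X => y.1 i j) (v.1 i j).
Proof.
apply: is_derive_cvg; apply: cvg_near_cst; near=> h.
have h0 : h != 0 by near: h; exact: nbhs_dnbhs_neq.
by rewrite !mxE addrK; apply: mulKf.
Unshelve. all: by end_near. Qed.

(** By [scaling_increment] and homogeneity, the difference quotient equals [scaling_deriv] at [L h]
    and [W h] exactly; these are continuous at 0, with the values in the statement. *)
Lemma is_derive_Phi (x v : X) i j : D x -> T v ->
  is_derive x v (fun y => Phi y i j)
    (scaling_deriv j0 (row_mx v.2.1 v.2.2) (Phi x)
      (\matrix_(k, l) (lam * v.1 k l * (x.1 k l)^-1)) i j).
Proof.
move=> Dx Tv; have [M0 _] := Dx.
pose V := row_mx v.2.1 v.2.2.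
pose L (h : R) := \matrix_(k, l) logmean (Phi (h *: v + x) k l) (Phi x k l).
pose dln (h : R) :=
  \matrix_(k < n, l < m) (lam * (ln ((h *: v + x).1 k l) - ln (x.1 k l))).
pose W (h : R) := \matrix_(k < n, l < m)
  (lam * v.1 k l * (logmean ((h *: v + x).1 k l) (x.1 k l))^-1).
have L0 : L 0 = Phi x.
  by apply/matrixP => k l; rewrite mxE scale0r add0r /logmean eqxx.
have W0 : W 0 = \matrix_(k, l) (lam * v.1 k l * (x.1 k l)^-1).
  by apply/matrixP => k l; rewrite [LHS]mxE [RHS]mxE scale0r add0r /logmean eqxx.
have Phi_line k l : Phi (h *: v + x) k l @[h --> (0 : R)] --> Phi x k l.
  have Pc := @Phi_continuous R n m lam n0 m0 x k l Dx.
  exact: (cvg_comp _ (fun y => Phi y k l) (@line_cvg_within x v Dx Tv) Pc).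
(* For continuity at 0, inverses need a nonzero value at 0 only. *)
pose P (f : R -> R) := f h @[h --> (0 : R)] --> f 0.
have PC : inverse_closed [set 0] P.
  split.
  - by move=> a; exact: cvg_cst.
  - by move=> f g Pf Pg; exact: cvgD.
  - by move=> f g Pf Pg; exact: cvgM.
  - by move=> f Pf f0; apply: cvgV => //; exact: f0.
have PL k l : P (fun h => L h k l).
  rewrite /P L0; under eq_cvg do rewrite mxE.
  by apply: cvg_logmean => //; exact: Phi_gt0.
have PW k l : P (fun h => W h k l).
  rewrite /P W0 mxE; under eq_cvg do rewrite mxE.
  apply: cvgMr; apply: cvgV; first by rewrite gt_eqF.
  apply: cvg_logmean => //.
  exact: (cvg_coord1 (nbhs_filter (0 : R)) (@line_cvg x v)).
apply: is_derive_cvg.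
have Pd : P (fun h => scaling_deriv j0 V (L h) (W h) i j).
  apply: (closed_scaling_deriv j0 V PC n0 _ PL PW) => h -> k l.
  by rewrite L0; exact: Phi_gt0.
have {}Pd : scaling_deriv j0 V (L h) (W h) i j @[h --> 0^'] -->
    scaling_deriv j0 V (L 0) (W 0) i j.
  by apply/(@continuous_withinNx R R (fun h => scaling_deriv j0 V (L h) (W h) i j)).
rewrite L0 W0 in Pd; apply: cvg_trans Pd.
apply: near_eq_cvg; near=> h.
have h0 : h != 0 by near: h; exact: nbhs_dnbhs_neq.
have Dh : D (h *: v + x).
  by near: h; apply: nbhs_dnbhs; exact: line_near_dom.
have [[B0 Br Bc] _] := PhiP lam n0 m0 Dx.
have [[B0' Br' Bc'] _] := PhiP lam n0 m0 Dh.
(* Logarithmic means also linearise the increment of $\ln M$ exactly, so [h] factors out. *)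
have dlnE : dln h = h *: W h.
  apply/matrixP => k l.
  have x0 := M0 k l; have x'0 : 0 < (h *: v + x).1 k l by case: Dh.
  have lm0 := logmean_gt0 x'0 x0.
  have xv : (h *: v + x).1 k l - x.1 k l = h * v.1 k l by rewrite !mxE addrK.
  have lnE : ln ((h *: v + x).1 k l) - ln (x.1 k l) =
      h * v.1 k l / logmean ((h *: v + x).1 k l) (x.1 k l).
    by rewrite -xv (sub_logmean x'0 x0) mulrC mulKf ?gt_eqF.
  by rewrite [LHS]mxE lnE [RHS]mxE [W h k l]mxE; ring.
have incr : Phi (h *: v + x) - Phi x =
    scaling_deriv j0 (row_mx (h *: v.2.1) (h *: v.2.2)) (L h) (dln h).
  apply: scaling_increment => //.
  - move=> k i' l j'; have := Phi_separable lam n0 m0 Dx Dh k i' l j'.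
    by rewrite !mxE.
  - move=> k; under eq_bigr do rewrite !mxE.
    by rewrite sumrB Br Br' !mxE addrK.
  - move=> l; under eq_bigr do rewrite !mxE.
    by rewrite sumrB Bc Bc' !mxE addrK.
rewrite dlnE -scale_row_mx scaling_derivZ in incr.
have -> : Phi (h *: v + x) i j - Phi x i j = (Phi (h *: v + x) - Phi x) i j.
  by rewrite !mxE.
rewrite incr [X in _ = _ *: X]mxE; apply/esym; exact: mulKf.
Unshelve. all: by end_near. Qed.

End PhiDerivative.

(** * Iterated derivatives as rational expressions in Phi and the matrix *)

Section Smoothness.
Variables (R : realType) (n m : nat) (lam : R).
Hypotheses (n0 : (0 < n)%N) (m0 : (0 < m)%N).

Local Notation X := ('M[R]_(n, m) * ('rV[R]_n * 'rV[R]_m))%type.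
Local Notation D := (@Phi_dom R n m).
Local Notation T := (@Phi_tangent R n m).
Local Notation Phi := (@Phi R n m lam).

(* The marginals are not among the generators: by [is_derive_Phi] the
   derivatives of [Phi] involve [Phi] and the matrix only. *)
Inductive Phi_rational : (X -> R) -> Prop :=
| Rational_cst a : Phi_rational (fun=> a)
| Rational_coord i j : Phi_rational (fun x => x.1 i j)
| Rational_Phi i j : Phi_rational (fun x => Phi x i j)
| RationalD f g : Phi_rational f -> Phi_rational g ->
    Phi_rational (fun x => f x + g x)
| RationalM f g : Phi_rational f -> Phi_rational g ->
    Phi_rational (fun x => f x * g x)
| RationalV f : Phi_rational f -> (forall x, D x -> f x != 0) ->
    Phi_rational (fun x => (f x)^-1).

Lemma Phi_rational_closed : inverse_closed D Phi_rational.
Proof.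
by split; [exact: Rational_cst|exact: RationalD|exact: RationalM|
  exact: RationalV].
Qed.

Lemma Phi_rational_continuous f : Phi_rational f ->
  forall x, D x -> f y @[y --> within D (nbhs x)] --> f x.
Proof.
move=> fR x Dx; have FF : Filter (within D (nbhs x)) by exact: within_filter.
elim: fR => [a|i j|i j|g h _ gc _ hc|g h _ gc _ hc|g _ gc g0].
- exact: cvg_cst.
- have idx : id y @[y --> within D (nbhs x)] --> x by exact: cvg_within.
  exact: (cvg_coord1 FF idx).
- exact: Phi_continuous.
- exact: cvgD.
- exact: cvgM.
- by apply: cvgV => //; exact: g0.
Qed.

(** The class is stable under tangent derivatives: [is_derive_Phi] handles the generator [Phi], and
    the rules of calculus do the rest. *)
Lemma Phi_rational_derive f v : Phi_rational f -> T v ->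
  exists2 g, Phi_rational g & forall x, D x -> is_derive x v f (g x).
Proof.
move=> fR Tv.
elim: fR => [a|i j|i j|g h gR [g' g'R dg] hR [h' h'R dh]|
  g h gR [g' g'R dg] hR [h' h'R dh]|g gR [g' g'R dg] g0].
- by exists (fun=> 0); [exact: Rational_cst|move=> x _; exact: is_derive_cst].
- exists (fun=> v.1 i j); first exact: Rational_cst.
  by move=> x _; exact: is_derive_coord1.
- exists (fun x => scaling_deriv (Ordinal m0) (row_mx v.2.1 v.2.2) (Phi x)
    (\matrix_(k, l) (lam * v.1 k l * (x.1 k l)^-1)) i j); last first.
    by move=> x Dx; exact: is_derive_Phi.
  apply: (closed_scaling_deriv _ _ Phi_rational_closed n0).
  + by move=> x Dx k l; exact: Phi_gt0.
  + by move=> k l; exact: Rational_Phi.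
  + move=> k l; under eq_fun do rewrite mxE.
    apply: RationalM; first exact: Rational_cst.
    apply: RationalV; first exact: Rational_coord.
    by move=> x [M0 _]; rewrite gt_eqF.
- exists (fun x => g' x + h' x); first exact: RationalD.
  by move=> x Dx; have := is_deriveD (dg x Dx) (dh x Dx).
- exists (fun x => g x * h' x + h x * g' x).
    by apply: RationalD; exact: RationalM.
  by move=> x Dx; have := is_deriveM (dg x Dx) (dh x Dx).
- exists (fun x => (-1) * ((g x)^-1 * (g x)^-1) * g' x).
    apply: RationalM => //; apply: RationalM; first exact: Rational_cst.
    by apply: RationalM; exact: RationalV.
  move=> x Dx; have [dgx dgE] := dg x Dx; split.
    by apply: derivableV => //; exact: g0.
  rewrite deriveV//; last exact: g0.
  by rewrite dgE mulN1r -invfM -expr2.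
Qed.

(** [D] has no interior in the ambient space, but agreement on [D] suffices because the line through
    [x] along [v] stays in [D] for small parameters. *)
Lemma is_derive_eq_on (f g : X -> R) x v l : D x -> T v ->
  (forall y, D y -> f y = g y) -> is_derive x v g l -> is_derive x v f l.
Proof.
move=> Dx Tv fg [/cvg_ex[/= l' gl'] gl].
have gl'E : 'D_v g x = l' by exact: cvg_lim gl'.
rewrite -gl gl'E; apply: is_derive_cvg; apply: cvg_trans gl'.
apply: near_eq_cvg; near=> h; rewrite /= !fg//.
by near: h; apply: nbhs_dnbhs; exact: line_near_dom.
Unshelve. all: by end_near. Qed.

(** Induction on [vs]: agreement on [D] is enough to differentiate once more, and the rational class
    absorbs the result. *)
Lemma Phi_iter_deriv (vs : seq X) : (forall v, v \in vs -> T v) ->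
  exists2 g : 'I_n -> 'I_m -> X -> R, forall i j, Phi_rational (g i j) &
    forall x, D x -> forall i j, iter_deriv Phi vs x i j = g i j x.
Proof.
elim: vs => [_|v vs IH Tvs].
  exists (fun i j x => Phi x i j) => //; exact: Rational_Phi.
have Tv : T v by apply: Tvs; rewrite inE eqxx.
have [w wvs|g gR gE] := IH; first by apply: Tvs; rewrite inE wvs orbT.
pose dg i j := cid2 (Phi_rational_derive (gR i j) Tv).
exists (fun i j => s2val (dg i j)) => [i j|x Dx i j]; first exact: s2valP.
have dF k l : is_derive x v (fun y => iter_deriv Phi vs y k l) (s2val (dg k l) x).
  apply: (is_derive_eq_on Dx Tv (g := g k l)); first by move=> y Dy; exact: gE.
  exact: (s2valP' (dg k l)) x Dx.
rewrite /= derive_mx; last by apply/derivable_mxP => k l; have [] := dF k l.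
by rewrite mxE; have [] := dF i j.
Qed.

End Smoothness.

Theorem theorem1 (R : realType) (n m : nat) (lam : R) :
  (0 < n)%N -> (0 < m)%N -> 0 < lam ->
  smooth_on (@Phi_tangent R n m) (@Phi_dom R n m) (@Phi R n m lam).
Proof.
move=> n0 m0 _ vs Tvs.
(* Continuity and differentiability are both checked entrywise on the rational representatives
   [g]. *)
have [g gR gE] := Phi_iter_deriv lam n0 m0 Tvs.
split.
  apply/subspace_continuousP => x Dx; apply/cvg_mxP => i j.
  rewrite (gE x Dx); apply: cvg_trans (Phi_rational_continuous n0 m0 (gR i j) Dx).
  apply: near_eq_cvg; near=> y; rewrite gE//.
  by near: y; exact: near_withinT.
move=> v x Tv Dx; apply/derivable_mxP => i j.
have [g' _ dg] := Phi_rational_derive n0 m0 (gR i j) Tv.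
have [//] := is_derive_eq_on Dx Tv (fun y Dy => gE y Dy i j) (dg x Dx).
Unshelve. all: by end_near. Qed.
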